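(* Let $\alpha$ and $\beta$ be dotted compositions. Then the monomial quasisymmetric functions in superspace multiply as $$M_\alpha M_\beta=\sum_P\operatorname{sign}(P)\,M_{\Gamma(P)},$$ where the sum is over all $(\alpha,\beta)$ overlapping shuffles $P$ and $\operatorname{sign}(P)=(-1)^{d(P)}$, with $d(P)$ the number of dots below the path $P$.
   Context: Variables $x_1,x_2,\dots$ commute; $\theta_1,\theta_2,\dots$ anticommute ($\theta_i\theta_j=-\theta_j\theta_i$, $\theta_i^2=0$) and commute with the $x$'s; coefficients are in $\mathbb Q$. A dotted composition $\alpha=(\alpha_1,\dots,\alpha_l)$ is a finite sequence whose entries belong to $\{1,2,3,\dots\}$ (non-dotted) or $\{\dot0,\dot1,\dot2,\dots\}$ (dotted); its length is $\ell(\alpha)=l$. Put $\eta_i=1$ if $\alpha_i$ is dotted and $\eta_i=0$ otherwise. The monomial quasisymmetric function in superspace is $$M_\alpha=\sum_{i_1<i_2<\cdots<i_l}\theta_{i_1}^{\eta_1}\cdots\theta_{i_l}^{\eta_l}\,x_{i_1}^{\alpha_1}\cdots x_{i_l}^{\alpha_l},$$ where dots are ignored in the exponents of the $x$'s, and $M_\emptyset=1$. For $\alpha$ of length $\ell$ and $\beta$ of length $\ell'$, consider the grid of unit cells in $[0,\ell]\times[0,\ell']$; columns are labelled $q=1,\dots,\ell$ from left to right by the parts $\alpha_q$, and rows $p=1,\dots,\ell'$ from bottom to top by the parts $\beta_p$. A dot is placed in (the centre of) the cell in row $p$ and column $q$ whenever $\alpha_q$ and $\beta_p$ are both dotted. An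 $(\alpha,\beta)$ overlapping shuffle is a lattice path $P$ from $(0,0)$ to $(\ell,\ell')$ with steps $(1,0)$, $(0,1)$ and $(1,1)$ that takes no diagonal step across a cell containing a dot. The dotted composition $\Gamma(P)=\gamma$ has one part per step: if the $h$-th step is horizontal over column $q$, $\gamma_h=\alpha_q$; if it is vertical over row $p$, $\gamma_h=\beta_p$; if it is diagonal over the cell in row $p$, column $q$, $\gamma_h=\alpha_q+\beta_p$, dotted if one of $\alpha_q,\beta_p$ is dotted. In the first two cases $\gamma_h$ is dotted exactly when the corresponding part is. *)

(* Defs.v *)
From HB Require Import structures.
From mathcomp Require Import all_boot all_order all_algebra finmap.
From mathcomp.multinomials Require Import monalg.
From mathcomp Require Import all_classical.

Set Implicit Arguments.
Unset Strict Implicit.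
Unset Printing Implicit Defensive.

Import GRing.Theory.
Local Open Scope classical_set_scope.
Local Open Scope ring_scope.

(** * Formal power series in superspace

   The variables are indexed by [nat], i.e. [xvar i] and [theta i] stand for
   x_(i+1) and theta_(i+1).  The pair [(S, m)] encodes the basis monomial
   theta_(s_1) ... theta_(s_k) x^m with S = {s_1 < ... < s_k}; every monomial
   is, up to sign, of this form or zero. *)
Definition smonom : Type := ({fset nat} * {cmonom nat})%type.

HB.instance Definition _ := Choice.on smonom.

Definition smul (u v : smonom) : smonom := ((u.1 `|` v.1)%fset, mmul u.2 v.2).

Definition smone : smonom := (fset0, mone).

(* theta_S theta_T = theta_sign S T * theta_(S u T): reordering the product
   costs one transposition for each pair s > t, and theta_i ^ 2 = 0. *)
Definition inversions (S T : {fset nat}) : nat :=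
  (\sum_(s <- S) \sum_(t <- T) (t < s))%N.

Definition theta_sign (S T : {fset nat}) : rat :=
  if [disjoint S & T]%fset then (-1) ^+ inversions S T else 0.

(* A series is the family of its coefficients. *)
Definition superseries : Type := smonom -> rat.

HB.instance Definition _ := GRing.Zmodule.copy superseries (smonom -> rat).

(* The product of series; the sum is finite by [finite_factorizations]. *)
Definition ssmul (f g : superseries) : superseries := fun w =>
  \sum_(p \in [set p : smonom * smonom | smul p.1 p.2 = w])
     (theta_sign p.1.1 p.2.1 * f p.1 * g p.2).

Definition monomial (u : smonom) : superseries := fun w => (w == u)%:R.

Lemma smulC : commutative smul.
Proof. by move=> u v; rewrite /smul fsetUC mulmC. Qed.

Lemma smulA : associative smul.
Proof. by move=> u v w; rewrite /smul /= fsetUA mulmA. Qed.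

Lemma smul1m : left_id smone smul.
Proof. by case=> S m; rewrite /smul /= fset0U mul1m. Qed.

Lemma smulm1 : right_id smone smul.
Proof. by move=> u; rewrite smulC smul1m. Qed.

Definition divisors (w : smonom) : set smonom :=
  [set u | exists v, smul u v = w].

Lemma finite_divisors w : finite_set (divisors w).
Proof.
case: w => S m; set E := finsupp m.
pose N := (\sum_(i <- E) m i)%N.
pose mk (g : {ffun E -> 'I_N.+1}) : {cmonom nat} :=
  mkcmonom [fsfun i : E => nat_of_ord (g i) | 0%N].
pose A := [set` fpowerset S]; pose B := mk @` [set: {ffun E -> 'I_N.+1}].
have fAB : finite_set (A `*` B)%classic.
  by apply: finite_setX; [exact: finite_fset | exact/finite_image/finite_finset].
apply: sub_finite_set fAB => -[T n] /= [[T' n'] [TS nm]]; split => /=.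
  by rewrite /A /= fpowersetE -TS fsubsetUl.
have le_nm i : (n i <= m i)%N by rewrite -nm cmM leq_addr.
have le_mN i : i \in E -> (m i <= N)%N.
  by move=> iE; rewrite /N (big_fsetD1 i) //= leq_addr.
exists [ffun i : E => inord (n (val i))] => //.
apply/eqP/cmP => i; rewrite /mk cmE /= fsfun_ffun.
case: insubP => [j iE ij|].
  rewrite /= ffunE inordK ?ltnS; first by rewrite -ij.
  by rewrite (leq_trans (le_nm _)) ?le_mN // -ij.
move=> iE; have /eqP mi0 : m i == 0%N by rewrite cmE_eq0.
by apply/esym/eqP; have := le_nm i; rewrite mi0 leqn0.
Qed.

Lemma finite_factorizations w :
  finite_set [set p : smonom * smonom | smul p.1 p.2 = w].
Proof.
apply: (@sub_finite_set _ _ (divisors w `*` divisors w)%classic).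
  by case=> u v /= uvw; split; [exists v | exists u; rewrite smulC].
by apply: finite_setX; exact: finite_divisors.
Qed.

Lemma ssmulE (D : {fset smonom}) f g w :
    (forall u v, smul u v = w -> (u \in D) && (v \in D)) ->
  ssmul f g w = \sum_(u <- D) \sum_(v <- D)
    if smul u v == w then theta_sign u.1 v.1 * f u * g v else 0.
Proof.
move=> wD; rewrite /ssmul.
pose G p : rat := if smul p.1 p.2 == w then
  theta_sign p.1.1 p.2.1 * f p.1 * g p.2 else 0.
transitivity (\sum_(p \in [set p : smonom * smonom | smul p.1 p.2 = w]) G p).
  by apply: eq_fsbigr => p; rewrite inE /= /G => ->; rewrite eqxx.
rewrite (fsbig_fwiden [seq (u, v) | u <- D, v <- D]).
- exact: big_allpairs.
- by move=> [u v] /= /wD /andP[uD vD]; apply/allpairsP; exists (u, v).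
- by apply: allpairs_uniq => // -[u v] [u' v'].
- by move=> [u v] /= [_ /eqP]; rewrite /G => /negPf /= ->.
Qed.

Lemma sum_pick (D : {fset smonom}) (a : smonom) (F : smonom -> rat) :
  \sum_(v <- D) (if v == a then F v else 0) = if a \in D then F a else 0.
Proof.
case: ifPn => aD.
  rewrite (big_fsetD1 a) //= eqxx big_seq big1 ?addr0 // => v.
  by rewrite !inE => /andP[/negPf ->].
rewrite big_seq big1 // => v vD; case: eqP => // va.
by rewrite -va vD in aD.
Qed.

Lemma sum_fsetU (S T : {fset nat}) (F : nat -> nat) : [disjoint S & T]%fset ->
  (\sum_(i <- (S `|` T)%fset) F i = \sum_(i <- S) F i + \sum_(i <- T) F i)%N.
Proof.
move=> dST; rewrite -big_cat; apply/perm_big/uniq_perm => //.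
  rewrite cat_uniq !fset_uniq andbT /= -all_predC; apply/allP => i iT /=.
  by move: i iT; exact/fdisjointP_sym.
by move=> i; rewrite mem_cat in_fsetU.
Qed.

Lemma inversionsUl S T U : [disjoint S & T]%fset ->
  inversions (S `|` T)%fset U = (inversions S U + inversions T U)%N.
Proof. by move=> dST; rewrite /inversions sum_fsetU. Qed.

Lemma inversionsUr S T U : [disjoint T & U]%fset ->
  inversions S (T `|` U)%fset = (inversions S T + inversions S U)%N.
Proof.
move=> dTU; rewrite /inversions -big_split; apply: eq_bigr => s _.
by rewrite sum_fsetU.
Qed.

Lemma theta_signA S T U :
  theta_sign S (T `|` U)%fset * theta_sign T U =
  theta_sign S T * theta_sign (S `|` T)%fset U.
Proof.
rewrite /theta_sign fdisjointXU fdisjointUX.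
have [dST|] := boolP [disjoint S & T]%fset; last by rewrite !mul0r.
have [dSU|] := boolP [disjoint S & U]%fset; last by rewrite mul0r mulr0.
have [dTU|] := boolP [disjoint T & U]%fset; last by rewrite !mulr0.
by rewrite /= -!exprD inversionsUl // inversionsUr // addnA.
Qed.

Lemma ssmulA : associative ssmul.
Proof.
move=> f g h; apply/funext => w.
set D := fset_set (divisors w).
have inD u : (u \in D) = `[< divisors w u >].
  by rewrite in_fset_set ?inE //; exact: finite_divisors.
have D_div u v x : smul u v = x -> x \in D -> (u \in D) && (v \in D).
  move=> uvx; rewrite !inD => /asboolP[y xyw].
  apply/andP; split; apply/asboolP.
    by exists (smul v y); rewrite smulA uvx.
  by exists (smul u y); rewrite smulA (smulC v) uvx.
have wD : w \in D by rewrite inD; apply/asboolP; exists smone; rewrite smulm1.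
rewrite !(@ssmulE D); try by move=> u v /D_div; exact.
transitivity (\sum_(u <- D) \sum_(v <- D) \sum_(t <- D)
  if smul u (smul v t) == w then
    theta_sign u.1 (v.1 `|` t.1)%fset * theta_sign v.1 t.1 * f u * g v * h t
  else 0).
  apply: eq_bigr => u _.
  transitivity (\sum_(x <- D) \sum_(v <- D) \sum_(t <- D)
    if x == smul v t then if smul u x == w then
       theta_sign u.1 x.1 * theta_sign v.1 t.1 * f u * g v * h t else 0 else 0).
    rewrite big_seq [RHS]big_seq; apply: eq_bigr => x xD.
    rewrite (@ssmulE D); last by move=> v t /D_div; exact.
    case: ifP => _; last first.
      by rewrite big1 // => v _; rewrite big1 // => t _; rewrite if_same.
    rewrite mulr_sumr; apply: eq_bigr => v _.
    rewrite mulr_sumr; apply: eq_bigr => t _.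
    rewrite eq_sym; case: eqP => // _; last by rewrite mulr0.
    by rewrite !mulrA -!(mulrA (theta_sign u.1 x.1)) (mulrC (f u)).
  rewrite exchange_big; apply: eq_bigr => v _.
  rewrite exchange_big; apply: eq_bigr => t _ /=.
  rewrite sum_pick; case: ifPn => // vtD.
  by case: eqP => // /D_div; rewrite wD => /(_ isT) /andP[_ /(negP vtD)].
transitivity (\sum_(x <- D) \sum_(u <- D) \sum_(v <- D) \sum_(t <- D)
  if x == smul u v then if smul x t == w then
     theta_sign u.1 v.1 * theta_sign x.1 t.1 * f u * g v * h t else 0 else 0).
  rewrite [RHS]exchange_big; apply: eq_bigr => u _.
  rewrite [RHS]exchange_big; apply: eq_bigr => v _.
  rewrite [RHS]exchange_big; apply: eq_bigr => t _ /=.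
  rewrite sum_pick smulA; have [_|uvD] := boolP (smul u v \in D).
    by case: eqP => // _; rewrite theta_signA.
  by case: eqP => // /D_div; rewrite wD => /(_ isT) /andP[/(negP uvD)].
rewrite big_seq [RHS]big_seq; apply: eq_bigr => x xD.
under eq_bigr => u _ do rewrite exchange_big.
rewrite exchange_big; apply: eq_bigr => t _ /=.
rewrite (@ssmulE D); last by move=> u v /D_div; exact.
case: ifP => _; last first.
  by rewrite big1 // => u _; rewrite big1 // => v _; rewrite if_same.
rewrite mulr_sumr mulr_suml; apply: eq_bigr => u _.
rewrite mulr_sumr mulr_suml; apply: eq_bigr => v _.
rewrite eq_sym; case: eqP => // _; last by rewrite mulr0 mul0r.
by rewrite !mulrA (mulrC (theta_sign x.1 t.1)).
Qed.

Definition ssone : superseries := monomial smone.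

Lemma theta_sign0S S : theta_sign fset0 S = 1.
Proof. by rewrite /theta_sign fdisjoint0X /inversions big_seq_fset0. Qed.

Lemma theta_signS0 S : theta_sign S fset0 = 1.
Proof.
rewrite /theta_sign fdisjointX0 /inversions big1 // => s _.
by rewrite big_seq_fset0.
Qed.

Lemma ssmul1s : left_id ssone ssmul.
Proof.
move=> f; apply/funext => w; rewrite /ssmul.
rewrite (fsbigD1 (smone, w)) /= ?smul1m //; last exact: finite_factorizations.
rewrite fsbig1 /= ?theta_sign0S /ssone /monomial ?eqxx ?mul1r ?addr0 //.
move=> -[u v] /= [uv_w neq].
have [uu|] := eqVneq u smone; last by rewrite mulr0 mul0r.
by case: neq; rewrite -uv_w uu smul1m.
Qed.

Lemma ssmuls1 : right_id ssone ssmul.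
Proof.
move=> f; apply/funext => w; rewrite /ssmul.
rewrite (fsbigD1 (w, smone)) /= ?smulm1 //; last exact: finite_factorizations.
rewrite fsbig1 /= ?theta_signS0 /ssone /monomial ?eqxx ?mul1r ?mulr1 ?addr0 //.
move=> -[u v] /= [uv_w neq].
have [vv|] := eqVneq v smone; last by rewrite mulr0.
by case: neq; rewrite -uv_w vv smulm1.
Qed.

Lemma ssmulDl : left_distributive ssmul +%R.
Proof.
move=> f g h; apply/funext => w.
rewrite -[RHS]/(ssmul f h w + ssmul g h w) /ssmul -fsbig_split /=; last exact: finite_factorizations.
by apply: eq_fsbigr => p _; rewrite -mulrDl -mulrDr.
Qed.

Lemma ssmulDr : right_distributive ssmul +%R.
Proof.
move=> f g h; apply/funext => w.
rewrite -[RHS]/(ssmul f g w + ssmul f h w) /ssmul -fsbig_split /=; last exact: finite_factorizations.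
by apply: eq_fsbigr => p _; rewrite -mulrDr.
Qed.

Lemma ssone_neq0 : ssone != 0.
Proof.
apply/eqP => /(congr1 (fun f : superseries => f smone)).
by rewrite /ssone /monomial eqxx.
Qed.

HB.instance Definition _ := GRing.Zmodule_isNzRing.Build superseries
  ssmulA ssmul1s ssmuls1 ssmulDl ssmulDr ssone_neq0.

Lemma monomialM u v w :
  (monomial u * monomial v) w = theta_sign u.1 v.1 * monomial (smul u v) w.
Proof.
rewrite -[LHS]/(ssmul _ _ w) /ssmul /monomial.
have [->|neq_w] := eqVneq w (smul u v); last first.
  rewrite mulr0 fsbig1 // => -[u' v'] /= uv_w.
  have [uu|] := eqVneq u' u; last by rewrite mulr0 mul0r.
  have [vv|] := eqVneq v' v; last by rewrite mulr0.
  by rewrite -uv_w uu vv eqxx in neq_w.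
rewrite (fsbigD1 (u, v)) /= ?eqxx //; last exact: finite_factorizations.
rewrite fsbig1 /= ?mulr1 ?addr0 // => -[u' v'] /= [_ neq].
have [uu|] := eqVneq u' u; last by rewrite mulr0 mul0r.
have [vv|] := eqVneq v' v; last by rewrite mulr0.
by case: neq; rewrite uu vv.
Qed.

Lemma monomialC u v : theta_sign u.1 v.1 = theta_sign v.1 u.1 ->
  monomial u * monomial v = monomial v * monomial u.
Proof. by move=> uv; apply/funext => w; rewrite !monomialM uv smulC. Qed.

Definition theta (i : nat) : superseries := monomial ([fset i]%fset, mone).

Definition xvar (i : nat) : superseries := monomial (fset0, ucm i).

Lemma theta_anticomm i j : theta i * theta j = - (theta j * theta i).
Proof.
apply/funext => w; rewrite -[RHS]/(- ((theta j * theta i) w)) !monomialM.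
rewrite smulC -mulNr; congr (_ * _).
rewrite /theta_sign !fdisjoint1X /= !inE /inversions !big_seq_fset1 eq_sym.
by case: ltngtP => //=; rewrite ?expr1 ?expr0 ?opprK ?oppr0.
Qed.

Lemma theta_sqr i : theta i * theta i = 0.
Proof.
apply/funext => w; rewrite monomialM /theta_sign fdisjoint1X !inE eqxx.
exact: mul0r.
Qed.

Lemma xvarC i j : xvar i * xvar j = xvar j * xvar i.
Proof. by apply: monomialC; rewrite !theta_sign0S. Qed.

Lemma theta_xvarC i j : theta i * xvar j = xvar j * theta i.
Proof. by apply: monomialC; rewrite theta_sign0S theta_signS0. Qed.

(** * Dotted compositions and monomial quasisymmetric functions *)

(* A part is its value together with a bit telling whether it is dotted. *)
Definition dpart : Type := (bool * nat)%type.

HB.instance Definition _ := Countable.on dpart.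

Definition dotted (a : dpart) : bool := a.1.

Definition pvalue (a : dpart) : nat := a.2.

Definition part0 : dpart := (false, 0%N).

Definition dotted_composition (alpha : seq dpart) : bool :=
  all (fun a => dotted a || (0 < pvalue a)%N) alpha.

Definition Mterm (alpha : seq dpart) (i : (size alpha).-tuple nat) :
    superseries :=
  \prod_(k < size alpha) theta (tnth i k) ^+ dotted (nth part0 alpha k) *
  \prod_(k < size alpha) xvar (tnth i k) ^+ pvalue (nth part0 alpha k).

(* Coefficientwise, the sum over i_1 < ... < i_l is finite when [alpha] is a
   dotted composition: see [finite_Mterm]. *)
Definition Mqsym (alpha : seq dpart) : superseries := fun w =>
  \sum_(i \in [set i : (size alpha).-tuple nat | sorted ltn i]) Mterm i w.

(** * Overlapping shuffles *)

Inductive step := Hor | Ver | Diag.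

Definition step_code (s : step) : 'I_3 :=
  match s with Hor => inord 0 | Ver => inord 1 | Diag => inord 2 end.

Definition step_decode (i : 'I_3) : step :=
  match val i with 0 => Hor | 1 => Ver | _ => Diag end.

Lemma step_codeK : cancel step_code step_decode.
Proof. by case; rewrite /step_decode /= inordK. Qed.

HB.instance Definition _ := Finite.copy step (can_type step_codeK).

Definition xmove (s : step) : nat :=
  match s with Ver => 0 | _ => 1 end.

Definition ymove (s : step) : nat :=
  match s with Hor => 0 | _ => 1 end.

(* The lattice point (xpos P h, ypos P h) is reached after h steps.  The next
   step goes over column [xpos P h] if it is horizontal, over row [ypos P h] if
   it is vertical, and over the cell where they meet if it is diagonal, rows
   and columns being numbered from 0. *)
Definition xpos (P : seq step) (h : nat) : nat :=
  (\sum_(s <- take h P) xmove s)%N.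

Definition ypos (P : seq step) (h : nat) : nat :=
  (\sum_(s <- take h P) ymove s)%N.

Section Shuffles.
Variables alpha beta : seq dpart.

Definition dot (p q : nat) : bool :=
  dotted (nth part0 alpha q) && dotted (nth part0 beta p).

(* Every step moves right or up, so such a path has at most
   [size alpha + size beta] steps: the overlapping shuffles form a finite subset
   of {bseq (size alpha + size beta) of step}. *)
Definition overlapping_shuffle (P : seq step) : bool :=
  [&& xpos P (size P) == size alpha,
      ypos P (size P) == size beta
    & all (fun h => (nth Hor P h == Diag) ==> ~~ dot (ypos P h) (xpos P h))
          (iota 0 (size P))].

Definition Gamma_part (P : seq step) (h : nat) : dpart :=
  let a := nth part0 alpha (xpos P h) in
  let b := nth part0 beta (ypos P h) in
  match nth Hor P h with
  | Hor => a
  | Ver => b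
  | Diag => (dotted a || dotted b, (pvalue a + pvalue b)%N)
  end.

Definition Gamma (P : seq step) : seq dpart :=
  [seq Gamma_part P h | h <- iota 0 (size P)].

(* The centre (q + 1/2, p + 1/2) of the cell is below the path when the step h
   crossing column q has height (ypos P h + ypos P h.+1) / 2 > p + 1/2 at the
   abscissa q + 1/2. *)
Definition below (P : seq step) (p q : nat) : bool :=
  has (fun h => [&& nth Hor P h != Ver, xpos P h == q
                  & (p.*2.+1 < ypos P h + ypos P h.+1)%N])
      (iota 0 (size P)).

Definition dots_below (P : seq step) : nat :=
  #|[pred c : 'I_(size beta) * 'I_(size alpha) | dot c.1 c.2 && below P c.1 c.2]|.

End Shuffles.

Lemma theta_prod n (i : nat -> nat) (b : nat -> bool) :
    (forall j k, (j < k < n)%N -> (i j < i k)%N) ->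
  \prod_(k < n) theta (i k) ^+ b k =
  monomial (\big[@fsetU _/fset0]_(k < n) (if b k then [fset i k] else fset0)%fset, mone).
Proof.
elim: n => [|n IHn] lt_i; first by rewrite !big_ord0.
rewrite !big_ord_recr IHn /=; last first.
  by move=> j k /andP[jk kn]; apply: lt_i; rewrite jk ltnW.
case: (b n); last by rewrite expr0 mulr1 fsetU0.
rewrite expr1; apply/funext => w; rewrite monomialM /theta_sign /smul /= mulm1.
set S := (\big[@fsetU _/fset0]_(k < n) _ : {fset nat}).
have ltS s : s \in S -> (s < i n)%N.
  case/bigfcupP => k _; case: ifP => // _; rewrite inE => /eqP ->.
  by apply: lt_i; rewrite ltn_ord /= ltnSn.
rewrite fdisjointX1; case: ifPn => [_|/negPn /ltS]; last by rewrite ltnn.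
rewrite /inversions big_seq big1 ?mul1r // => s /ltS lt_s.
by rewrite big_seq_fset1 ltnNge ltnW.
Qed.

Lemma xvar_prod n (i a : nat -> nat) :
  \prod_(k < n) xvar (i k) ^+ a k =
  monomial (fset0, \big[mmul/mone]_(k < n) \big[mmul/mone]_(j < a k) ucm (i k)).
Proof.
have mM : {morph (fun m : {cmonom nat} => monomial (fset0, m)) :
    m n / mmul m n >-> m * n}.
  move=> m m'; apply/funext => w.
  by rewrite monomialM theta_sign0S mul1r /smul /= fsetU0.
rewrite (big_morph _ mM (erefl _)); apply: eq_bigr => k _.
by rewrite (big_morph _ mM (erefl _)) /= big_const_ord -Monoid.iteropE.
Qed.

Lemma Mterm_monomial alpha (i : (size alpha).-tuple nat) : sorted ltn i ->
  Mterm i = monomial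
    (\big[@fsetU _/fset0]_(k < size alpha)
        (if dotted (nth part0 alpha k) then [fset tnth i k] else fset0)%fset,
     \big[mmul/mone]_(k < size alpha)
        \big[mmul/mone]_(j < pvalue (nth part0 alpha k)) ucm (tnth i k)).
Proof.
move=> lt_i; rewrite /Mterm.
have lt_nth j k : (j < k < size alpha)%N -> (nth 0%N i j < nth 0%N i k)%N.
  move=> /andP[jk kn]; apply: (sorted_ltn_nth ltn_trans 0%N lt_i) => //.
    by rewrite inE size_tuple (ltn_trans jk).
  by rewrite inE size_tuple.
under eq_bigr => k _ do rewrite (tnth_nth 0%N).
rewrite (@theta_prod _ (nth 0%N i) (fun k => dotted (nth part0 alpha k))) //.
under [X in _ * X]eq_bigr => k _ do rewrite (tnth_nth 0%N).
rewrite (@xvar_prod _ (nth 0%N i) (fun k => pvalue (nth part0 alpha k))).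
apply/funext => w; rewrite monomialM theta_signS0 mul1r /smul /= fsetU0 mul1m.
congr (monomial (_, _) w).
  by apply: eq_bigr => k _; rewrite (tnth_nth 0%N).
by apply: eq_bigr => k _; apply: eq_bigr => j _; rewrite (tnth_nth 0%N).
Qed.

Lemma finite_Mterm alpha w : dotted_composition alpha ->
  finite_set [set i : (size alpha).-tuple nat | sorted ltn i /\ Mterm i w != 0].
Proof.
case: w => S m al_comp; set n := size alpha.
pose E := (S `|` finsupp m)%fset.
apply: (@sub_finite_set _ _ (range (fun t : n.-tuple E => map_tuple val t))).
  move=> i [lt_i]; rewrite Mterm_monomial // /monomial.
  rewrite Num.Theory.pnatr_eq0 eqb0 negbK => /eqP[ES Em].
  have iE k : tnth i k \in E.
    rewrite in_fsetU; have /(all_nthP part0)/(_ _ (ltn_ord k)) := al_comp.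
    case/orP => [dk|vk]; apply/orP; [left; rewrite ES|right; rewrite Em].
      by apply/bigfcupP; exists k; rewrite ?mem_index_enum // dk inE.
    rewrite -cmE_neq0 (bigD1 k) //= cmM -(prednK vk) big_ord_recl cmM cmUU.
    by [].
  exists [tuple [` iE k]%fset | k < n] => //.
  by apply: eq_from_tnth => k; rewrite tnth_map tnth_mktuple.
exact/finite_image/finite_finset.
Qed.

(* Main.v *)
(* Both sides are compared after truncation to finitely many variables, which is
   harmless since a coefficient of a product only depends on the coefficients of
   the divisors of the monomial.  Let M be the truncation to the variables of
   index at least m, M' the truncation to those of index at least m + 1, and
   u(a) = theta_m^eta x_m^a; then M_(a,alpha) = M'_(a,alpha) + u(a) M'_alpha.
   Expanding the product of (a,alpha) and (b,beta) gives four terms: the product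
   of the M', which is handled by induction on the number of variables, and three
   others which correspond to the paths starting with a horizontal, a vertical
   and a diagonal step.  Moving u(b) to the left across M'_alpha costs one sign
   per dotted part of alpha when b is dotted, i.e. one per dot of row 0 that the
   vertical or diagonal step leaves below the path. *)

Require Import Defs.
From mathcomp Require Import all_boot all_order all_algebra finmap.
From mathcomp.multinomials Require Import monalg.
From mathcomp Require Import all_classical.

Import GRing.Theory.
Local Open Scope ring_scope.

(** * Peeling off the first step of a path *)

Lemma step_eqE : ((Hor == Ver = false) * (Diag == Ver = false) *
  (Hor == Diag = false) * (Ver == Diag = false))%type.
Proof. by do ?split; apply/eqP. Qed.

Lemma xpos_cons s P h : xpos (s :: P) h.+1 = (xmove s + xpos P h)%N.
Proof. by rewrite /xpos /= big_cons. Qed.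

Lemma ypos_cons s P h : ypos (s :: P) h.+1 = (ymove s + ypos P h)%N.
Proof. by rewrite /ypos /= big_cons. Qed.

Lemma xpos0 P : xpos P 0 = 0%N.
Proof. by rewrite /xpos take0 big_nil. Qed.

Lemma ypos0 P : ypos P 0 = 0%N.
Proof. by rewrite /ypos take0 big_nil. Qed.

Lemma iota0S n : iota 0 n.+1 = 0%N :: [seq h.+1 | h <- iota 0 n].
Proof. by rewrite /= (iotaDl 1). Qed.

Lemma dot_drop alpha beta m n p q :
  dot (drop m alpha) (drop n beta) p q = dot alpha beta (n + p) (m + q).
Proof. by rewrite /dot !nth_drop. Qed.

(** The first step uses up [xmove s] parts of [alpha] and [ymove s] parts of [beta]; the grid seen
    from its endpoint is that of the remaining parts. *)
Lemma overlapping_shuffle_cons alpha beta s P :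
  overlapping_shuffle alpha beta (s :: P) =
  [&& (xmove s <= size alpha)%N, (ymove s <= size beta)%N,
      (s == Diag) ==> ~~ dot alpha beta 0 0
    & overlapping_shuffle (drop (xmove s) alpha) (drop (ymove s) beta) P].
Proof.
have eq_drop m n d : (m + n == d)%N = (m <= d)%N && (n == d - m)%N.
  case: leqP => [md|dm]; first by rewrite -{1}(subnKC md) eqn_add2l.
  by apply/negbTE; rewrite neq_ltn (leq_trans dm) ?leq_addr ?orbT.
rewrite /overlapping_shuffle [size (_ :: _)]/= iota0S [all _ (_ :: _)]/= all_map.
rewrite xpos_cons ypos_cons !size_drop xpos0 ypos0 !eq_drop.
under eq_all => h do rewrite /= xpos_cons ypos_cons -dot_drop.
by rewrite -!andbA; congr (_ && _); rewrite andbCA;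
  congr (_ && _); rewrite !(andbCA (_ ==> _)).
Qed.

Lemma overlapping_shuffle_nil alpha beta :
  overlapping_shuffle alpha beta [::] = nilp alpha && nilp beta.
Proof. by rewrite /overlapping_shuffle /= xpos0 ypos0 andbT !(eq_sym 0%N). Qed.

Lemma Gamma_cons alpha beta s P :
  Gamma alpha beta (s :: P) =
  Gamma_part alpha beta [:: s] 0
    :: Gamma (drop (xmove s) alpha) (drop (ymove s) beta) P.
Proof.
rewrite /Gamma [size (_ :: _)]/= iota0S [map _ (_ :: _)]/= -map_comp.
congr (_ :: _).
by apply: eq_map => h; rewrite /Gamma_part /= xpos_cons ypos_cons !nth_drop.
Qed.

(** Lets the right-hand side be truncated too: a merged part without dot adds two undotted parts,
    whose values are positive. *)
Lemma dotted_composition_Gamma alpha beta P :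
  dotted_composition alpha -> dotted_composition beta ->
  overlapping_shuffle alpha beta P ->
  dotted_composition (Gamma alpha beta P).
Proof.
elim: P alpha beta => [//|s P IHP] alpha beta al_comp be_comp.
rewrite overlapping_shuffle_cons Gamma_cons => /and4P[sa sb _ /IHP] /= ->.
- rewrite andbT /Gamma_part !xpos0 !ypos0 /=.
  case: s sa sb => /=; case: alpha al_comp => [|a alpha] //=.
  + by case/andP.
  + by case: beta be_comp => // b beta /= /andP[].
  + by case: beta be_comp => // b beta /= /andP[].
  case: beta be_comp => // b beta /= /andP[pb _] /andP[pa _] _ _.
  rewrite addn_gt0; move: pa pb; rewrite /dotted /pvalue.
  by case: a.1 => //= ->; rewrite orbT.
- by apply/allP => a /mem_drop; exact: (allP al_comp).
- by apply/allP => b /mem_drop; exact: (allP be_comp).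
Qed.

(** The first step has mean height at most 1/2, so no cell is below it; the other steps are
    translated together with the cell. *)
Lemma below_cons s P p q :
  below (s :: P) (ymove s + p) (xmove s + q) = below P p q.
Proof.
rewrite /below [size (_ :: _)]/= iota0S [has _ (_ :: _)]/= has_map xpos0 ypos0.
rewrite ypos_cons ypos0 addn0 add0n.
rewrite [_ && _](_ : _ = false) /=; last first.
  by case: s => //=; rewrite ?andbF // ltnS andbF.
apply: eq_has => h /=; rewrite xpos_cons !ypos_cons eqn_add2l; congr [&& _, _ & _].
by rewrite doubleD addnACA -addnn -addnS ltn_add2l.
Qed.

(** Column 0 is crossed by the first step alone, at mean height at most 1/2, hence not above the
    centre of any cell. *)
Lemma below_cons_column0 s P p : xmove s = 1%N -> below (s :: P) p 0 = false.
Proof.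
move=> s1; rewrite /below [size (_ :: _)]/= iota0S [has _ (_ :: _)]/= has_map.
rewrite ypos0 ypos_cons ypos0 addn0 add0n.
have -> : (p.*2.+1 < ymove s)%N = false by case: s {s1}.
rewrite !andbF /=; apply/hasPn => h _ /=.
by rewrite xpos_cons s1 add1n andbF.
Qed.

(** A discrete intermediate value argument: the abscissa grows by at most 1 per step, and not at all
    on vertical steps. *)
Lemma crossing_step P q : (q < xpos P (size P))%N ->
  exists2 h, (h < size P)%N & (nth Hor P h != Ver) && (xpos P h == q).
Proof.
elim: P q => [|s P IHP] q; first by rewrite xpos0.
rewrite /= xpos_cons; case: (ltnP q (xmove s)) => [qs _|sq].
  by exists 0%N => //=; case: s qs => /=; rewrite ?xpos0 ?step_eqE; case: q.
rewrite -{1}(subnKC sq) ltn_add2l => /IHP[h hP /andP[nV /eqP hq]].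
by exists h.+1 => //=; rewrite nV xpos_cons hq subnKC ?eqxx.
Qed.

(** All later steps run at height at least 1, above the centres of row 0. *)
Lemma below_cons_row0 s P q : ymove s = 1%N -> (q < xpos P (size P))%N ->
  below (s :: P) 0 (xmove s + q).
Proof.
move=> s1 /crossing_step[h hP /andP[nV /eqP hq]].
apply/hasP; exists h.+1; first by rewrite mem_iota.
rewrite /= nV xpos_cons hq eqxx !ypos_cons s1 /=.
by rewrite double0 !add1n addSn addnS.
Qed.

Lemma dots_belowE alpha beta P :
  dots_below alpha beta P =
  (\sum_(p < size beta) \sum_(q < size alpha)
     (dot alpha beta p q && below P p q))%N.
Proof.
rewrite /dots_below pair_big /= -sum1_card big_mkcond /=.
by apply: eq_bigr => -[p q] _ /=; rewrite inE /=; case: (_ && _).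
Qed.

Lemma sum_dotted alpha : (\sum_(q < size alpha) dotted (nth part0 alpha q))%N =
  count dotted alpha.
Proof.
rewrite -sum1_count [RHS]big_mkcond (big_nth part0) big_mkord.
by apply: eq_bigr => q _; case: ifP.
Qed.

Lemma dots_below_nil alpha beta : dots_below alpha beta [::] = 0%N.
Proof.
by rewrite dots_belowE big1 // => p _; rewrite big1 // => q _; rewrite andbF.
Qed.

Lemma dots_below_Hor a alpha beta P :
  dots_below (a :: alpha) beta (Hor :: P) = dots_below alpha beta P.
Proof.
rewrite !dots_belowE; apply: eq_bigr => p _.
rewrite big_ord_recl below_cons_column0 // andbF add0n.
by apply: eq_bigr => q _; rewrite -(below_cons Hor P p q).
Qed.

(* The step crosses row 0 before any of the columns of [alpha], so every cell of
   that row ends up below the path. *)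
Lemma dots_below_Ver alpha b beta P : xpos P (size P) = size alpha ->
  dots_below alpha (b :: beta) (Ver :: P) =
  (dotted b * count dotted alpha + dots_below alpha beta P)%N.
Proof.
move=> Pa; rewrite !dots_belowE big_ord_recl; congr (_ + _)%N.
  rewrite -sum_dotted big_distrr; apply: eq_bigr => q _ /=.
  by rewrite (@below_cons_row0 Ver) ?Pa // andbT mulnb andbC.
apply: eq_bigr => p _; apply: eq_bigr => q _.
by rewrite -(below_cons Ver P p q).
Qed.

(** The diagonal step crosses column 0 without leaving a cell of it below; over the remaining
    columns the count is as for a vertical step. *)
Lemma dots_below_Diag a alpha b beta P : xpos P (size P) = size alpha ->
  dots_below (a :: alpha) (b :: beta) (Diag :: P) =
  (dotted b * count dotted alpha + dots_below alpha beta P)%N.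
Proof.
move=> Pa; rewrite !dots_belowE big_ord_recl; congr (_ + _)%N.
  rewrite big_ord_recl below_cons_column0 // andbF add0n.
  rewrite -sum_dotted big_distrr; apply: eq_bigr => q _ /=.
  by rewrite (@below_cons_row0 Diag) ?Pa // andbT mulnb andbC.
apply: eq_bigr => p _; rewrite big_ord_recl below_cons_column0 // andbF add0n.
by apply: eq_bigr => q _; rewrite -(below_cons Diag P p q).
Qed.

Lemma mulr_signCA (R : pzRingType) (x y : R) n :
  x * ((-1) ^+ n * y) = (-1) ^+ n * (x * y).
Proof. by rewrite mulrA (commr_sign x n) mulrA. Qed.

(** * Enumeration of step words of bounded length *)

Fixpoint paths (n : nat) : seq (seq step) :=
  if n is n'.+1 then
    [::] :: [seq s :: P | s <- [:: Hor; Ver; Diag], P <- paths n']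
  else [:: [::]].

Lemma pathsS n : paths n.+1 =
  [::] :: [seq s :: P | s <- [:: Hor; Ver; Diag], P <- paths n].
Proof. by []. Qed.

Lemma mem_paths n P : (P \in paths n) = (size P <= n)%N.
Proof.
elim: n P => [|n IHn] [|s P] //; rewrite pathsS inE orFb.
apply/allpairsP/idP => [[[s' P'] [_ + [_ ->]]]|Pn]; first by rewrite IHn.
by exists (s, P); split; rewrite ?IHn //=; case: s Pn => _;
  rewrite !inE eqxx ?orbT.
Qed.

Lemma paths_uniq n : uniq (paths n).
Proof.
elim: n => [|n IHn] //.
rewrite pathsS cons_uniq; apply/andP; split.
  by apply/negP => /allpairsP[[s P] []].
apply: allpairs_uniq => //; last by move=> [s P] [s' P'] _ _ /= [-> ->].
by rewrite /= !inE !step_eqE.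
Qed.

Lemma sum_paths_step (V : zmodType) n (Q : pred (seq step)) (F : seq step -> V) :
  \sum_(P <- paths n.+1 | Q P) F P =
  (if Q [::] then F [::] else 0) +
  (\sum_(P <- paths n | Q (Hor :: P)) F (Hor :: P) +
   \sum_(P <- paths n | Q (Ver :: P)) F (Ver :: P) +
   \sum_(P <- paths n | Q (Diag :: P)) F (Diag :: P)).
Proof.
have -> : paths n.+1 = [::] :: map (cons Hor) (paths n) ++
    map (cons Ver) (paths n) ++ map (cons Diag) (paths n).
  by rewrite /= cats0.
rewrite big_cons !big_cat !big_map /= addrA.
by case: ifP => _; rewrite ?add0r // !addrA.
Qed.

Lemma overlapping_shuffle_xpos alpha beta P :
  overlapping_shuffle alpha beta P -> xpos P (size P) = size alpha.
Proof. by case/and3P => /eqP. Qed.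

(** * Products of truncations in a ring with the superspace relations *)

Section AbstractTerms.
Variables (R : pzRingType) (u : nat -> dpart -> R).

Hypothesis u_swap : forall i j a b,
  u i a * u j b = (-1) ^+ (dotted b * dotted a) * (u j b * u i a).

Hypothesis u_mul : forall i a b,
  u i a * u i b =
  if dotted a && dotted b then 0
  else u i (dotted a || dotted b, (pvalue a + pvalue b)%N).

(* For [u := pterm], this is the part of [Mqsym alpha] which only involves the
   variables with an index in [m, m + k). *)
Fixpoint Mtrunc (k m : nat) (alpha : seq dpart) : R :=
  match alpha, k with
  | [::], _ => 1
  | _ :: _, 0%N => 0
  | a :: alpha', k'.+1 => Mtrunc k' m.+1 alpha + u m a * Mtrunc k' m.+1 alpha'
  end.

(** The terms whose first part takes the index [m]. The value 0 on the empty composition removes the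
    empty path in [sum_paths_lead]. *)
Definition Mlead (k m : nat) (alpha : seq dpart) : R :=
  if alpha is a :: alpha' then u m a * Mtrunc k m.+1 alpha' else 0.

Lemma MtruncS k m alpha :
  Mtrunc k.+1 m alpha = Mtrunc k m.+1 alpha + Mlead k m alpha.
Proof. by case: alpha => [|a alpha] //=; case: k => [|k]; rewrite addr0. Qed.

(** A term has one factor per part of [alpha], and [u j b] changes sign at each dotted one when [b]
    is dotted. The total sign is the same for all terms, so it factors out. *)
Lemma Mtrunc_swap k m alpha j b :
  Mtrunc k m alpha * u j b =
  (-1) ^+ (dotted b * count dotted alpha) * (u j b * Mtrunc k m alpha).
Proof.
elim: k m alpha => [|k IHk] m [|a alpha].
- by rewrite /= muln0 mul1r mulr1 mul1r.
- by rewrite /= mul0r !mulr0.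
- by rewrite /= muln0 mul1r mulr1 mul1r.
rewrite MtruncS mulrDl IHk mulrDr mulrDr; congr (_ + _).
rewrite /= -mulrA IHk mulr_signCA (mulrA (u m a)) u_swap.
by rewrite mulnDr addnC exprD -!mulrA.
Qed.

Section LeadingVariable.
Variables k m : nat.

Hypothesis IH : forall n alpha beta, (size alpha + size beta <= n)%N ->
  Mtrunc k m.+1 alpha * Mtrunc k m.+1 beta =
  \sum_(P <- paths n | overlapping_shuffle alpha beta P)
    (-1) ^+ dots_below alpha beta P * Mtrunc k m.+1 (Gamma alpha beta P).

Lemma sum_paths_Hor n alpha beta : (size alpha + size beta <= n.+1)%N ->
  \sum_(P <- paths n | overlapping_shuffle alpha beta (Hor :: P))
    (-1) ^+ dots_below alpha beta (Hor :: P) *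
    Mlead k m (Gamma alpha beta (Hor :: P)) =
  Mlead k m alpha * Mtrunc k m.+1 beta.
Proof.
case: alpha => [|a alpha] le_n.
  by rewrite mul0r big_pred0 // => P; rewrite overlapping_shuffle_cons.
have {}le_n : (size alpha + size beta <= n)%N := le_n.
rewrite /Mlead -mulrA (IH _ _ _ le_n) mulr_sumr.
apply: eq_big => [P|P _].
  by rewrite overlapping_shuffle_cons /= !drop0 step_eqE.
rewrite dots_below_Hor Gamma_cons /= !drop0 mulr_signCA.
by rewrite /Gamma_part /= xpos0.
Qed.

(** The sign for moving [u m b] to the left past the truncation of [alpha] is the one that
    [dots_below_Ver] attributes to row 0. *)
Lemma sum_paths_Ver n alpha beta : (size alpha + size beta <= n.+1)%N ->
  \sum_(P <- paths n | overlapping_shuffle alpha beta (Ver :: P))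
    (-1) ^+ dots_below alpha beta (Ver :: P) *
    Mlead k m (Gamma alpha beta (Ver :: P)) =
  Mtrunc k m.+1 alpha * Mlead k m beta.
Proof.
case: beta => [|b beta] le_n.
  by rewrite mulr0 big_pred0 // => P; rewrite overlapping_shuffle_cons andbF.
rewrite /= addnS ltnS in le_n.
rewrite /Mlead mulrA Mtrunc_swap -!mulrA (IH _ _ _ le_n) !mulr_sumr.
have OSV P : overlapping_shuffle alpha (b :: beta) (Ver :: P) =
    overlapping_shuffle alpha beta P.
  by rewrite overlapping_shuffle_cons /= !drop0 step_eqE.
apply: eq_big => [P|P]; rewrite OSV // => /overlapping_shuffle_xpos Pa.
rewrite dots_below_Ver // Gamma_cons /= !drop0 exprD -mulrA mulr_signCA.
by rewrite /Gamma_part /= ypos0.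
Qed.

(** [u m b] passes only the tail of [alpha] before it merges with [u m a]. The merged factor
    vanishes when both parts are dotted, which is exactly when the diagonal step is forbidden. *)
Lemma sum_paths_Diag n alpha beta : (size alpha + size beta <= n.+1)%N ->
  \sum_(P <- paths n | overlapping_shuffle alpha beta (Diag :: P))
    (-1) ^+ dots_below alpha beta (Diag :: P) *
    Mlead k m (Gamma alpha beta (Diag :: P)) =
  Mlead k m alpha * Mlead k m beta.
Proof.
case: alpha => [|a alpha] le_n.
  by rewrite mul0r big_pred0 // => P; rewrite overlapping_shuffle_cons.
case: beta le_n => [|b beta] le_n.
  by rewrite mulr0 big_pred0 // => P; rewrite overlapping_shuffle_cons andbF.
have {}le_n : (size alpha + size beta <= n)%N.
  by move: le_n; rewrite /= addSn ltnS addnS => /ltnW.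
rewrite /Mlead mulrA -(mulrA (u m a)) Mtrunc_swap mulr_signCA mulrA.
have OSD P : overlapping_shuffle (a :: alpha) (b :: beta) (Diag :: P) =
    ~~ (dotted a && dotted b) && overlapping_shuffle alpha beta P.
  by rewrite overlapping_shuffle_cons /= !drop0 eqxx.
have [dab|dab] := boolP (dotted a && dotted b).
  rewrite u_mul dab mul0r mulr0 mul0r big_pred0 // => P.
  by rewrite OSD dab.
rewrite u_mul (negbTE dab) -!mulrA (IH _ _ _ le_n) !mulr_sumr.
apply: eq_big => [P|P]; rewrite OSD dab // => /overlapping_shuffle_xpos Pa.
rewrite dots_below_Diag // Gamma_cons /= !drop0 exprD -mulrA mulr_signCA.
by rewrite /Gamma_part /= xpos0 ypos0.
Qed.

Lemma sum_paths_lead n alpha beta : (size alpha + size beta <= n)%N ->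
  \sum_(P <- paths n | overlapping_shuffle alpha beta P)
    (-1) ^+ dots_below alpha beta P * Mlead k m (Gamma alpha beta P) =
  Mlead k m alpha * Mtrunc k m.+1 beta + Mtrunc k m.+1 alpha * Mlead k m beta +
  Mlead k m alpha * Mlead k m beta.
Proof.
case: n => [|n] le_n.
  rewrite big_cons big_nil mulr0 add0r if_same.
  move: le_n; rewrite leqn0 addn_eq0 => /andP[/nilP -> /nilP ->].
  by rewrite !mul0r mulr0 !addr0.
rewrite sum_paths_step mulr0 if_same add0r.
by rewrite sum_paths_Hor // sum_paths_Ver // sum_paths_Diag.
Qed.

End LeadingVariable.

Lemma Mtrunc_mul k m n alpha beta : (size alpha + size beta <= n)%N ->
  Mtrunc k m alpha * Mtrunc k m beta =
  \sum_(P <- paths n | overlapping_shuffle alpha beta P)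
    (-1) ^+ dots_below alpha beta P * Mtrunc k m (Gamma alpha beta P).
Proof.
elim: k m n alpha beta => [|k IHk] m n alpha beta le_n.
  (* Without variables only the empty composition can have a nonzero truncation, so only the empty
     path counts. *)
  have M0 (gamma : seq dpart) : Mtrunc 0 m gamma = if nilp gamma then 1 else 0.
    by case: gamma.
  have sum_nil (F : seq step -> R) : (forall s P, F (s :: P) = 0) ->
      \sum_(P <- paths n | overlapping_shuffle alpha beta P) F P =
      if nilp alpha && nilp beta then F [::] else 0.
    move=> FS; case: n {le_n} => [|n].
      by rewrite big_cons big_nil overlapping_shuffle_nil addr0.
    by rewrite sum_paths_step overlapping_shuffle_nil !big1 ?addr0.
  rewrite sum_nil => [|s P]; last by rewrite Gamma_cons M0 mulr0.
  rewrite dots_below_nil mul1r !M0.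
  by case: (nilp alpha); case: (nilp beta); rewrite ?mul1r ?mul0r.
(* Each factor splits by whether index [m] is used. Of the four products, the one without it is
   [IHk] and the other three are [sum_paths_lead]. *)
rewrite !MtruncS mulrDl !mulrDr.
under eq_bigr => P _ do rewrite MtruncS mulrDr.
rewrite big_split /= sum_paths_lead //; last by move=> *; apply: IHk.
by rewrite -IHk // -!addrA; congr (_ + _); rewrite addrCA.
Qed.

End AbstractTerms.

Arguments Mtrunc {R}.

(** * Commutation and multiplication of single-variable terms *)

Section Terms.
Variable R : pzRingType.
Implicit Types (x y s t : R) (a b : bool).

Lemma commXX x y m n : GRing.comm x y -> x ^+ m * y ^+ n = y ^+ n * x ^+ m.
Proof. by move=> xy; exact/commrX/commr_sym/commrX/commr_sym. Qed.

Lemma super_swap x y s t a b m n :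
  GRing.comm x y -> GRing.comm x s -> GRing.comm x t -> GRing.comm y s ->
  s * t = - (t * s) ->
  s ^+ a * x ^+ m * (t ^+ b * y ^+ n) =
  (-1) ^+ (b * a) * (t ^+ b * y ^+ n * (s ^+ a * x ^+ m)).
Proof.
move=> xy xs xt ys st.
have xtE : x ^+ m * t ^+ b = t ^+ b * x ^+ m by exact: commXX.
have ysE : y ^+ n * s ^+ a = s ^+ a * y ^+ n by exact: commXX.
have xyE : x ^+ m * y ^+ n = y ^+ n * x ^+ m by exact: commXX.
have stE : s ^+ a * t ^+ b = (-1) ^+ (b * a) * (t ^+ b * s ^+ a).
  by case: a b {xtE ysE} => [] [] /=; rewrite ?mul1r ?mulr1 // mulN1r.
rewrite mulrA -(mulrA (s ^+ a)) xtE mulrA stE -!mulrA xyE.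
by rewrite (mulrA (y ^+ n)) ysE -!mulrA.
Qed.

Lemma super_mul x t a b m n : GRing.comm x t -> t * t = 0 ->
  t ^+ a * x ^+ m * (t ^+ b * x ^+ n) =
  if a && b then 0 else t ^+ (a || b) * x ^+ (m + n).
Proof.
move=> xt tt.
have xtE : x ^+ m * t ^+ b = t ^+ b * x ^+ m by exact: commXX.
rewrite mulrA -(mulrA (t ^+ a)) xtE mulrA -mulrA -(exprD x).
by case: a b {xtE} => [] [] /=; rewrite ?mul1r ?mulr1 // expr1 tt mul0r.
Qed.

End Terms.

Definition pterm (i : nat) (a : dpart) : superseries :=
  theta i ^+ dotted a * xvar i ^+ pvalue a.

(** Equal indices need no separate case: [theta_anticomm] then says 0 = -0. *)
Lemma pterm_swap i j a b :
  pterm i a * pterm j b =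
  (-1) ^+ (dotted b * dotted a) * (pterm j b * pterm i a).
Proof.
apply: super_swap; first exact: xvarC.
- exact/esym/theta_xvarC.
- exact/esym/theta_xvarC.
- exact/esym/theta_xvarC.
exact: theta_anticomm.
Qed.

Lemma pterm_mul i a b :
  pterm i a * pterm i b =
  if dotted a && dotted b then 0
  else pterm i (dotted a || dotted b, (pvalue a + pvalue b)%N).
Proof. by apply: super_mul; [exact/esym/theta_xvarC | exact: theta_sqr]. Qed.

(** * Truncations as sums over increasing index sequences *)

Fixpoint incseqs (k m l : nat) : seq (seq nat) :=
  match l, k with
  | 0%N, _ => [:: [::]]
  | _.+1, 0%N => [::]
  | l'.+1, k'.+1 =>
      incseqs k' m.+1 l ++ [seq m :: s | s <- incseqs k' m.+1 l']
  end.

Lemma mem_incseqs k m l s :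
  (s \in incseqs k m l) =
  [&& size s == l, sorted ltn s & all (fun i => m <= i < m + k)%N s].
Proof.
elim: k m l s => [|k IHk] m [|l] s.
- by case: s => [|i s] //=; rewrite inE.
- case: s => [|i s] //; rewrite [all _ _]/= addn0.
  by case: leqP => [mi|]; rewrite ?andbF // ltnNge mi !andbF.
- by case: s => [|i s] //=; rewrite inE.
rewrite mem_cat IHk; apply/orP/and3P => [[/and3P[sl srt sm]|/mapP[s' + ->]]|].
- split=> //; apply: sub_all sm => i; rewrite addSnnS.
  by case/andP => /ltnW -> ->.
- rewrite IHk => /and3P[/eqP sl srt sm]; split => /=; first by rewrite sl.
    rewrite path_sortedE; last exact: ltn_trans.
    by rewrite srt andbT; apply: sub_all sm => i /andP[].
  rewrite leqnn -addn1 leq_add2l /=; apply: sub_all sm => i; rewrite addSnnS.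
  by case/andP => /ltnW -> ->.
case: s => [|i s] [] //=; rewrite eqSS => sl.
rewrite path_sortedE; last exact: ltn_trans.
move=> /andP[is_ srt] /andP[/andP[mi ik] sm].
(* Only the first entry can equal [m]; this decides which half of the list contains the sequence. *)
have [im|im] := eqVneq i m.
  right; apply/mapP; exists s; last by rewrite im.
  rewrite IHk sl srt; apply/allP => j js.
  have /andP[_ jk] : (m <= j < m + k.+1)%N := allP sm j js.
  have ij : (i < j)%N := allP is_ j js.
  by rewrite addSnnS jk -im ij.
left; rewrite sl is_ srt /=.
have {}mi : (m < i)%N by rewrite ltn_neqAle eq_sym im.
rewrite mi addSnnS ik /=; apply/allP => j js.
have /andP[_ ->] : (m <= j < m + k.+1)%N := allP sm j js.
by rewrite (ltn_trans mi (allP is_ j js)).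
Qed.

Lemma incseqs_uniq k m l : uniq (incseqs k m l).
Proof.
elim: k m l => [|k IHk] m [|l] //=.
rewrite cat_uniq IHk map_inj_uniq ?IHk ?andbT => [|s s' [->]] //.
apply/hasPn => _ /mapP[s _ ->]; rewrite mem_incseqs /=.
by rewrite ltnn !andbF.
Qed.

Lemma mulrACA_comm (R : pzRingType) (x y z t : R) : GRing.comm z y ->
  x * y * (z * t) = x * z * (y * t).
Proof. by move=> zy; rewrite -mulrA (mulrA y) -zy -!mulrA. Qed.

(** [Mterm] on plain sequences, so that recursion on [alpha] does not change the type of the
    indices. *)
Definition seqterm (alpha : seq dpart) (s : seq nat) : superseries :=
  \prod_(k < size alpha) theta (nth 0%N s k) ^+ dotted (nth part0 alpha k) *
  \prod_(k < size alpha) xvar (nth 0%N s k) ^+ pvalue (nth part0 alpha k).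

(** The only reordering moves the power of [xvar i] past thetas, with which it commutes, so there is
    no sign. *)
Lemma seqterm_cons a alpha i s :
  seqterm (a :: alpha) (i :: s) = pterm i a * seqterm alpha s.
Proof.
rewrite /seqterm !big_ord_recl; apply: mulrACA_comm.
by apply: commr_prod => k _; apply/commrX/commr_sym/commrX/theta_xvarC.
Qed.

Lemma Mtrunc_incseqs k m alpha :
  Mtrunc pterm k m alpha = \sum_(s <- incseqs k m (size alpha)) seqterm alpha s.
Proof.
elim: k m alpha => [|k IHk] m [|a alpha].
- by rewrite big_seq1 /seqterm !big_ord0 mulr1.
- by rewrite big_nil.
- by rewrite big_seq1 /seqterm !big_ord0 mulr1.
rewrite [LHS]/= !IHk [incseqs _ _ _]/= big_cat big_map mulr_sumr; congr (_ + _).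
by apply: eq_bigr => s _; rewrite seqterm_cons.
Qed.

Lemma Mterm_seqterm alpha (i : (size alpha).-tuple nat) :
  Mterm i = seqterm alpha i.
Proof.
rewrite /Mterm; under eq_bigr => k _ do rewrite (tnth_nth 0%N).
by under [X in _ * X]eq_bigr => k _ do rewrite (tnth_nth 0%N).
Qed.

(** * Comparison of coefficients in finitely many variables *)

Definition supported (n : nat) (w : smonom) : Prop :=
  (forall i, i \in w.1 -> (i < n)%N) /\ (forall i, w.2 i != 0%N -> (i < n)%N).

Lemma supported_exists w : exists n, supported n w.
Proof.
pose E := (w.1 `|` finsupp w.2)%fset.
have leE i : i \in E -> (i < (\max_(j <- E) j).+1)%N.
  by move=> iE; rewrite ltnS;
    exact: (@leq_bigmax_seq _ (enum_fset E) predT (fun j => j) i iE isT).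
exists (\max_(j <- E) j)%N.+1; split => i iw; apply: leE; rewrite in_fsetU.
  by rewrite iw.
by rewrite -cmE_neq0 iw orbT.
Qed.

Lemma supported_smul n u v :
  supported n (smul u v) -> supported n u /\ supported n v.
Proof.
case=> nS nm; split; split => i iw; try by apply: nS; rewrite in_fsetU iw ?orbT.
  by apply: nm; rewrite cmM addn_eq0 negb_and iw.
by apply: nm; rewrite cmM addn_eq0 negb_and iw orbT.
Qed.

(** Equality after setting to 0 the variables of index at least [n]. *)
Definition agree (n : nat) (f g : superseries) : Prop :=
  forall w, supported n w -> f w = g w.

(** The coefficient of [w] in a product involves only divisors of [w], which are supported where [w]
    is. *)
Lemma agreeM n f f' g g' :
  agree n f f' -> agree n g g' -> agree n (f * g) (f' * g').
Proof.
move=> ff gg w nw; apply: eq_fsbigr => -[u v]; rewrite inE /= => uvw.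
rewrite -uvw in nw; have [nu nv] := supported_smul _ _ _ nw.
by rewrite ff // gg.
Qed.

Lemma agreeD n f f' g g' :
  agree n f f' -> agree n g g' -> agree n (f + g) (f' + g').
Proof. by move=> ff gg w nw; congr (_ + _); [exact: ff | exact: gg]. Qed.

Lemma superseries_sumE (I : Type) (r : seq I) (F : I -> superseries) w :
  (\sum_(i <- r) F i) w = \sum_(i <- r) F i w.
Proof. by elim/big_rec2: _ => // i x f _ <-. Qed.

(** Each part is dotted or positive, so every chosen index really occurs in the monomial, in a theta
    or an x. *)
Lemma Mterm_coef_lt n alpha (i : (size alpha).-tuple nat) w :
  dotted_composition alpha -> supported n w -> sorted ltn i -> Mterm i w != 0 ->
  all (fun j => j < n)%N i.
Proof.
case: w => S m al_comp [nS nm] lt_i; rewrite Mterm_monomial // /monomial.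
rewrite Num.Theory.pnatr_eq0 eqb0 negbK => /eqP[ES Em].
apply/all_tnthP => k.
have /(all_nthP part0)/(_ _ (ltn_ord k)) := al_comp.
case/orP => [dk|vk].
  by apply: nS; rewrite /= ES; apply/bigfcupP; exists k;
    rewrite ?mem_index_enum // dk inE.
apply: nm; rewrite /= Em (bigD1 k) //= cmM -(prednK vk) big_ord_recl cmM cmUU.
by [].
Qed.

Lemma Mqsym_agree n alpha : dotted_composition alpha ->
  agree n (Mqsym alpha) (Mtrunc pterm n 0 alpha).
Proof.
move=> al_comp w nw; rewrite Mtrunc_incseqs superseries_sumE.
set L := incseqs n 0 (size alpha).
pose r : seq ((size alpha).-tuple nat) := pmap insub L.
have LE : L = map val r.
  rewrite (pmap_filter (insubK _)); apply/esym/all_filterP/allP => s.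
  by rewrite mem_incseqs => /and3P[sl _ _] /=; rewrite insubT.
have mem_r i : (i \in r) = (val i \in L).
  by rewrite LE mem_map //; exact: val_inj.
have r_uniq : uniq r by apply: pmap_sub_uniq; exact: incseqs_uniq.
rewrite LE big_map (eq_bigr (fun i => Mterm i w)); last first.
  by move=> i _; rewrite Mterm_seqterm.
(* Sorted tuples outside [r] have an entry that is at least [n], so their term has coefficient 0 at
   [w]. *)
rewrite fsbig_seq // /Mqsym; apply/esym/fsbig_widen.
  by move=> i /=; rewrite mem_r mem_incseqs => /and3P[].
move=> i /= [lt_i nr]; apply/eqP/negP => /negP nz; apply: nr.
rewrite /= mem_r mem_incseqs size_tuple eqxx lt_i.
exact: (Mterm_coef_lt _ _ _ _ al_comp nw).
Qed.

(** Links the finite type indexing the sum of the theorem with the recursive list on which the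
    induction runs. *)
Lemma perm_paths n (Q : pred (seq step)) :
  perm_eq [seq val P | P <- enum {: {bseq n of step}} & Q (val P)]
          [seq P <- paths n | Q P].
Proof.
apply: uniq_perm.
- rewrite map_inj_uniq; first exact/filter_uniq/enum_uniq.
  by move=> P P' /val_inj.
- by rewrite filter_uniq ?paths_uniq.
move=> P; rewrite mem_filter mem_paths; apply/mapP/andP => [[P' + ->]|[QP Pn]].
  by rewrite mem_filter => /andP[QP _]; rewrite size_bseq.
by exists (Bseq Pn) => //; rewrite mem_filter QP mem_enum.
Qed.

Theorem proposition5p5 (alpha beta : seq dpart)
    (halpha : dotted_composition alpha) (hbeta : dotted_composition beta) :
  Mqsym alpha * Mqsym beta =
  \sum_(P : {bseq (size alpha + size beta) of step}
          | overlapping_shuffle alpha beta P)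
     (-1) ^+ dots_below alpha beta P * Mqsym (Gamma alpha beta P).
Proof.
(* [n] bounds the variables of [w], so both sides may be truncated at [n] when compared at [w]. *)
apply/funext => w; have [n nw] := supported_exists w.
rewrite (agreeM _ _ _ _ _ (Mqsym_agree n _ halpha) (Mqsym_agree n _ hbeta) _ nw).
rewrite (Mtrunc_mul _ _ pterm_swap pterm_mul n 0 _ _ _ (leqnn _)).
rewrite -big_filter -(perm_big _ (perm_paths _ _)) big_map big_filter.
(* It remains to exchange, path by path, the truncation of [Gamma] for the full series. *)
rewrite enumT; apply: (_ : agree n _ _) nw.
elim/big_rec2: _ => [//|P f g OSP fg]; apply: agreeD => //; apply: agreeM => //.
move=> w' nw'; apply/esym/(Mqsym_agree n) => //.
exact: dotted_composition_Gamma.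
Qed.
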